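(* Let $S=K[x_1,\ldots,x_n]$ be a polynomial ring over a field $K$. Every pretty $k$-clean monomial ideal $I\subset S$ is pretty clean. Conversely, every pretty clean monomial ideal $I\subset S$ is pretty $k$-clean for some integer $k\geq 0$.
   Context: For a monomial ideal $I\subset S$ put $\mathrm{ass}(I)=\mathrm{Ass}(S/I)$, the set of associated primes of $S/I$. For a monomial $u$, $\mathrm{supp}(u)$ is the set of variables dividing $u$. A prime filtration of a monomial ideal $I$ is a chain of monomial ideals $I=I_0\subset I_1\subset\cdots\subset I_r=S$ with $I_j/I_{j-1}\cong S/P_j$ for prime ideals $P_j$, $j=1,\ldots,r$. It is called pretty clean if for all $i<j$ with $P_i\subseteq P_j$ one has $P_i=P_j$. The ideal $I$ is called pretty clean if it has a pretty clean filtration. A non-unit monomial $u\notin I$ is called a pretty cleaner monomial of $I$ if for all $P\in\mathrm{ass}(I:u)$ and $Q\in\mathrm{ass}(I+Su)$ with $P\subseteq Q$ one has $P=Q$. Let $k\ge 0$. A monomial ideal $I\subset S$ is (recursively) called pretty $k$-clean if it is a prime ideal or there exists a pretty cleaner monomial $u\notin I$ of $I$ with $|\mathrm{supp}(u)|\leq k+1$ such that both $I:u$ and $I+Su$ are pretty $k$-clean. *)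

(* Defs.v *)
From HB Require Import structures.
From mathcomp Require Import all_boot all_order all_algebra.
From mathcomp Require Import boolp mpoly.

Set Implicit Arguments.
Unset Strict Implicit.
Unset Printing Implicit Defensive.

Import GRing.Theory.

Local Open Scope ring_scope.
Local Open Scope quotient_scope.

Section Submodule.
Variables (R : nzRingType) (V : lmodType R).

Record submod (A : submodClosed V) :=
  Submod { submod_val : V; submod_valP : submod_val \in A }.

Variable A : submodClosed V.

HB.instance Definition _ := [isSub for @submod_val A].
HB.instance Definition _ := [Choice of submod A by <:].
HB.instance Definition _ := [SubChoice_isSubLmodule of submod A by <:].

End Submodule.

Section QuotientModule.
Variables (R : nzRingType) (V : lmodType R) (B : submodClosed V).

(* A submodClosed does not record closure under opposite, being also meant for
   semimodules; Quotient.quot requires it. *)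
Definition zmod_pred : {pred V} := B.

Lemma zmod_pred_closed : zmod_closed zmod_pred.
Proof. exact: GRing.submod_closedB (submodClosedP B). Qed.

HB.instance Definition _ := GRing.isZmodClosed.Build V zmod_pred zmod_pred_closed.

Definition quotmod := Quotient.quot zmod_pred.

HB.instance Definition _ := GRing.Zmodule.on quotmod.
HB.instance Definition _ := EqQuotient.on quotmod.

Definition quotmod_scale (a : R) (x : quotmod) : quotmod :=
  \pi_quotmod (a *: repr x).

Lemma quotmod_eqP (x y : V) :
  reflect (\pi_quotmod x = \pi_quotmod y) (x - y \in B).
Proof. by rewrite (Quotient.idealrBE zmod_pred); apply: eqP. Qed.

Lemma pi_quotmodD : {morph \pi_quotmod : x y / x + y}.
Proof. exact: (@pi_addr _ _ _ _ _ (Quotient.quot zmod_pred)). Qed.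

Lemma pi_quotmodZ (a : R) (x : V) :
  \pi_quotmod (a *: x) = quotmod_scale a (\pi_quotmod x).
Proof.
apply/quotmod_eqP; rewrite -scalerBr; apply: rpredZ.
by apply/quotmod_eqP; rewrite reprK.
Qed.

Lemma quotmod_scaleA (a b : R) (x : quotmod) :
  quotmod_scale a (quotmod_scale b x) = quotmod_scale (a * b) x.
Proof. by rewrite -[x]reprK -(pi_quotmodZ b) -!pi_quotmodZ scalerA. Qed.

Lemma quotmod_scale1 : left_id 1 quotmod_scale.
Proof. by move=> x; rewrite -[x]reprK -pi_quotmodZ scale1r. Qed.

Lemma quotmod_scaleDr : right_distributive quotmod_scale +%R.
Proof.
move=> a x y; rewrite -[x]reprK -[y]reprK.
by rewrite -pi_quotmodD -!pi_quotmodZ scalerDr pi_quotmodD.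
Qed.

Lemma quotmod_scaleDl (x : quotmod) :
  {morph quotmod_scale^~ x : a b / a + b}.
Proof.
move=> a b /=; rewrite -[x]reprK.
by rewrite -!pi_quotmodZ scalerDl pi_quotmodD.
Qed.

HB.instance Definition _ := GRing.Zmodule_isLmodule.Build R quotmod
  quotmod_scaleA quotmod_scale1 quotmod_scaleDr quotmod_scaleDl.

End QuotientModule.

Section Subquotient.
Variables (R : nzRingType) (V : lmodType R) (A B : submodClosed V).

Definition restrict : {pred submod A} := fun x => val x \in B.

Lemma restrictE x : (x \in restrict) = (val x \in B).
Proof. by []. Qed.

Lemma restrict_closed : submod_closed restrict.
Proof.
split=> [|a x y]; first by rewrite restrictE raddf0 rpred0.
rewrite !restrictE linearP => xB yB.
by apply: rpredD => //; apply: rpredZ.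
Qed.

HB.instance Definition _ :=
  GRing.isSubmodClosed.Build R (submod A) restrict restrict_closed.

(* The module A / (A :&: B), i.e. A / B when B is contained in A. *)
Definition subquot : lmodType R := quotmod restrict.

End Subquotient.

Definition isomorphic (R : nzRingType) (M N : lmodType R) : Prop :=
  exists f : {linear M -> N}, bijective f.

Section Ideals.
Variable R : comNzRingType.

(* An ideal of R is a submodule of the regular module R^o, possibly the whole
   of R (the idealr of ring_quotient are proper).  Membership is boolean, which
   is no restriction thanks to the classical `[< _ >] of boolp. *)
Definition ideal := submodClosed R^o.

(* idealr_closed includes properness. *)
Definition prime_ideal (P : {pred R}) : Prop :=
  idealr_closed P /\ prime_idealr_closed P.

Definition associated (M : lmodType R) (P : {pred R}) : Prop :=
  prime_ideal P /\ exists m : M, forall r : R, (r \in P) = (r *: m == 0).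

Definition colon (I : ideal) (u : R) : {pred R^o} := fun f => f * u \in I.

Lemma colonE (I : ideal) (u f : R) : (f \in colon I u) = (f * u \in I).
Proof. by []. Qed.

Lemma colon_closed I u : submod_closed (colon I u).
Proof.
split=> [|a f g]; first by rewrite colonE mul0r; apply: (@rpred0 R^o I).
rewrite !colonE => fI gI.
rewrite mulrDl -mulrA; apply: (@rpredD R^o I) => //.
exact: (@rpredZ R R^o I a (f * u)).
Qed.

HB.instance Definition _ I u :=
  GRing.isSubmodClosed.Build R R^o (colon I u) (colon_closed I u).

Definition add_principal (I : ideal) (u : R) : {pred R^o} :=
  fun f => `[< exists2 g, g \in I & exists a : R, f = g + a * u >].

Lemma add_principalP (I : ideal) (u f : R) :
  reflect (exists2 g, g \in I & exists a : R, f = g + a * u)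
          (f \in add_principal I u).
Proof. exact: asboolP. Qed.

Lemma add_principal_closed I u : submod_closed (add_principal I u).
Proof.
split=> [|a f1 f2].
  apply/add_principalP; exists 0; first exact: (@rpred0 R^o I).
  by exists 0; rewrite mul0r addr0.
move=> /add_principalP[g1 g1I [a1 ->]] /add_principalP[g2 g2I [a2 ->]].
apply/add_principalP; exists (a *: g1 + g2).
  by apply: (@rpredD R^o I) => //; apply: rpredZ.
by exists (a * a1 + a2); rewrite scalerDr mulrDl -mulrA addrACA.
Qed.

HB.instance Definition _ I u := GRing.isSubmodClosed.Build R R^o
  (add_principal I u) (add_principal_closed I u).

End Ideals.

Section PrettyClean.
Variables (n : nat) (K : fieldType).
Local Notation S := {mpoly K[n]}.
Implicit Types (I : ideal S) (u : 'X_{1..n}).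

Definition ass I : {pred S} -> Prop := @associated S (quotmod I).

(* A monomial 'X_[u] is represented by its exponent vector u. *)
Definition monomial_ideal I : Prop :=
  exists G : {pred 'X_{1..n}}, forall f : S,
    f \in I <-> exists2 s : seq (S * 'X_{1..n}),
      {in s, forall p, p.2 \in G} & f = \sum_(p <- s) p.1 * 'X_[p.2].

Definition supp u : {set 'I_n} := [set i | (U_(i) <= u)%MM].

(* The primes of the filtration are P 1, ..., P r; its inclusions are strict
   because the modules S / P j are nonzero. *)
Definition prime_filtration I (r : nat) (F P : nat -> ideal S) : Prop :=
  [/\ F 0%N =i I, F r =i predT,
      forall j, (j <= r)%N -> monomial_ideal (F j) &
      forall j, (0 < j <= r)%N ->
        [/\ {subset F j.-1 <= F j}, prime_ideal (P j) &
            isomorphic (subquot (F j) (F j.-1)) (quotmod (P j))]].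

(* With r = 0 the unit ideal is pretty clean, whereas it is never pretty
   k-clean: it is not prime and contains every monomial. *)
Definition pretty_clean I : Prop :=
  exists r F P, prime_filtration I r F P /\
    forall i j, (0 < i)%N -> (i < j)%N -> (j <= r)%N ->
      {subset P i <= P j} -> P i =i P j.

Definition pretty_cleaner I u : Prop :=
  [/\ 'X_[K, u] \isn't a GRing.unit, 'X_[u] \notin I &
      forall P Q : {pred S}, ass (colon I 'X_[u]) P ->
        ass (add_principal I 'X_[u]) Q -> {subset P <= Q} -> P =i Q].

Inductive pretty_k_clean (k : nat) : ideal S -> Prop :=
| pretty_k_clean_prime I :
    monomial_ideal I -> prime_ideal I -> pretty_k_clean k I
| pretty_k_clean_cleaner I u :
    monomial_ideal I -> pretty_cleaner I u -> (#|supp u| <= k.+1)%N ->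
    pretty_k_clean k (colon I 'X_[u]) ->
    pretty_k_clean k (add_principal I 'X_[u]) -> pretty_k_clean k I.

End PrettyClean.

(* Main.v *)
Require Import Defs.
From HB Require Import structures.
From mathcomp Require Import all_boot all_order all_algebra.
From mathcomp Require Import boolp mpoly.

(* Pretty k-clean implies pretty clean: a filtration of I : u, multiplied by u
   and added to I, climbs from I to I + S u, where a filtration of I + S u takes
   over.  The primes of a pretty clean filtration are all associated, so the
   cleaner condition on u makes the concatenation pretty.
   Conversely, the first step F_1 of a pretty clean filtration of I is generated
   over I by a monomial u with I : u = P_1 prime, and I + S u = F_1 carries the
   rest of the filtration, whose primes include Ass(S / F_1); hence u is a
   pretty cleaner and one concludes by induction on the length. *)

Set Implicit Arguments.
Unset Strict Implicit.
Unset Printing Implicit Defensive.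

Import GRing.Theory.

Local Open Scope ring_scope.
Local Open Scope quotient_scope.

(** * Ideals, associated primes and cyclic subquotients in terms of elements *)

Section IdealTheory.
Variable R : comNzRingType.
Implicit Types (A B I P : ideal R) (Q : {pred R}) (u : R).

Lemma ideal0 I : 0 \in I. Proof. exact: (@rpred0 R^o I). Qed.

Lemma idealD I : {in I &, forall f g, f + g \in I}.
Proof. by move=> f g fI gI; apply: (@rpredD R^o I). Qed.

Lemma idealMl I a f : f \in I -> a * f \in I.
Proof. exact: (@rpredZ R R^o I a f). Qed.

Lemma idealB I : {in I &, forall f g, f - g \in I}.
Proof. by move=> f g fI gI; rewrite idealD // -mulN1r idealMl. Qed.

Lemma idealDl I f g : f \in I -> (f + g \in I) = (g \in I).
Proof.
move=> fI; apply/idP/idP => [fgI|]; last exact: idealD.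
by rewrite -(addKr f g) addrC idealB.
Qed.

Lemma prime_ideal_eq Q Q' : Q =i Q' -> prime_ideal Q -> prime_ideal Q'.
Proof. by move=> eqQ; rewrite (_ : Q = Q') //; apply/funext. Qed.

Lemma prime_ideal1 Q : prime_ideal Q -> 1 \notin Q.
Proof. by case=> -[]. Qed.

Lemma prime_idealMr Q a b :
  prime_ideal Q -> a \notin Q -> (b * a \in Q) = (b \in Q).
Proof.
case=> -[Q0 _ Qlin] Qprime aQ; apply/idP/idP => [/Qprime|bQ].
  by rewrite (negPf aQ) orbF.
by rewrite mulrC -[a * b]addr0 Qlin.
Qed.

Lemma quotmod_pi0 (V : lmodType R) (B : submodClosed V) (x : V) :
  (\pi_(quotmod B) x == 0) = (x \in B).
Proof.
have -> : 0 = \pi_(quotmod B) 0 :> quotmod B by rewrite [RHS]pi_zeror.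
by apply/eqP/idP => [/quotmod_eqP|xB]; [|apply/quotmod_eqP]; rewrite subr0.
Qed.

Lemma associatedP I Q :
  associated (quotmod I) Q <->
  prime_ideal Q /\ exists m, forall a, (a \in Q) = (a * m \in I).
Proof.
split=> -[Qprime [m Qm]]; split=> //.
  exists (repr m) => a.
  by rewrite Qm -{1}[m]reprK -[_ *: _]pi_quotmodZ quotmod_pi0.
by exists (\pi_(quotmod I) m) => a; rewrite Qm -[_ *: _]pi_quotmodZ quotmod_pi0.
Qed.

(** The preimage of the class of 1 generates M with annihilator P. Conversely, the coefficient [c y]
    chosen with y = c y x is determined modulo P only, which makes its class in R / P linear in
    y. *)
Lemma isomorphic_quotmodP (M : lmodType R) P :
  isomorphic M (quotmod P) <->
  exists x : M, (forall y, exists a, y = a *: x) /\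
                (forall a, (a \in P) = (a *: x == 0)).
Proof.
pose one : quotmod P := \pi_(quotmod P) (1 : R^o).
have piZ (a : R) : \pi_(quotmod P) (a : R^o) = a *: one.
  by rewrite -[RHS]pi_quotmodZ /GRing.scale /= mulr1.
split=> [[f [g fK gK]]|[x [genx annx]]].
  have finj := can_inj fK.
  exists (g one); split=> [y|a].
    exists (repr (f y)); apply: finj.
    by rewrite linearZ gK /= -piZ reprK.
  by rewrite -(inj_eq finj) linearZ linear0 gK /= -piZ quotmod_pi0.
pose c y := sval (cid (genx y)).
have cE y : y = c y *: x by rewrite /c; case: cid.
pose f y := \pi_(quotmod P) (c y : R^o).
have flin : linear f.
  move=> a y z.
  rewrite -[a *: f y]pi_quotmodZ /f -pi_quotmodD.
  apply/quotmod_eqP; rewrite annx scalerBl -cE scalerDl -scalerA -!cE.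
  by rewrite subrr.
pose F := HB.pack_for {linear M -> quotmod P} f
  (GRing.isLinear.Build R M (quotmod P) *:%R f flin).
exists F; exists (fun q : quotmod P => repr q *: x) => [y|q].
  apply/eqP; rewrite [y in _ == y]cE -subr_eq0 -scalerBl -annx.
  by apply/quotmod_eqP; rewrite reprK.
rewrite -[RHS]reprK; apply/quotmod_eqP.
by rewrite annx scalerBl -cE subrr.
Qed.

(** Here m lifts a generator of A / (A :&: B) with annihilator P, so that subquotients can be
    handled without quotient types. *)
Definition cyclic_factor A B P : Prop :=
  exists m, [/\ m \in A, forall f, f \in A -> exists a, f - a * m \in B
                & forall a, (a \in P) = (a * m \in B)].

Lemma isomorphic_subquotP A B P :
  isomorphic (subquot A B) (quotmod P) <-> cyclic_factor A B P.
Proof.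
rewrite isomorphic_quotmodP; split=> [[x [genx annx]]|[m [mA genm annm]]].
  have pix a : a *: x = \pi_(subquot A B) (a *: repr x).
    by rewrite [RHS]pi_quotmodZ reprK.
  exists (val (repr x)); split=> [|f fA|a]; first exact: submod_valP.
    have [a] := genx (\pi_(subquot A B) (Submod fA)).
    by rewrite pix => /quotmod_eqP eqa; exists a.
  by rewrite annx pix quotmod_pi0.
pose x : submod A := Submod mA.
have pix a : a *: \pi_(subquot A B) x = \pi_(subquot A B) (a *: x).
  by rewrite [RHS]pi_quotmodZ.
exists (\pi_(subquot A B) x); split=> [y|a].
  have [a aB] := genm _ (submod_valP (repr y)).
  by exists a; rewrite pix -[LHS]reprK; apply/quotmod_eqP.
by rewrite annm pix quotmod_pi0.
Qed.

Lemma cyclic_factor_eqr A B B' P :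
  B =i B' -> cyclic_factor A B P -> cyclic_factor A B' P.
Proof.
move=> eqB [m [mA genm annm]]; exists m; split=> // [f|a]; last by rewrite -eqB.
by move/genm=> [a]; rewrite eqB; exists a.
Qed.

(* The ideal I + G * u, the shape of the filtration steps between I and
   I + R * u. *)
Definition add_scaled I u (G : ideal R) : {pred R^o} :=
  fun f => `[< exists2 g, g \in I & exists2 h, h \in G & f = g + h * u >].

Lemma add_scaledP I u (G : ideal R) f :
  reflect (exists2 g, g \in I & exists2 h, h \in G & f = g + h * u)
          (f \in add_scaled I u G).
Proof. exact: asboolP. Qed.

Lemma add_scaled_closed I u G : submod_closed (add_scaled I u G).
Proof.
split=> [|a f1 f2].
  apply/add_scaledP; exists 0; first exact: ideal0.
  by exists 0; rewrite ?ideal0 ?mul0r ?addr0.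
move=> /add_scaledP[g1 g1I [h1 h1G ->]] /add_scaledP[g2 g2I [h2 h2G ->]].
apply/add_scaledP; exists (a * g1 + g2); first by rewrite idealD ?idealMl.
exists (a * h1 + h2); first by rewrite idealD ?idealMl.
by rewrite /GRing.scale /= mulrDr mulrDl addrACA mulrA.
Qed.

HB.instance Definition _ I u G := GRing.isSubmodClosed.Build R R^o
  (add_scaled I u G) (add_scaled_closed I u G).

Lemma add_scaledS I u (G G' : ideal R) :
  {subset G <= G'} -> {subset add_scaled I u G <= add_scaled I u G'}.
Proof.
move=> sG f /add_scaledP[g gI [h hG ->]].
by apply/add_scaledP; exists g => //; exists h => //; apply: sG.
Qed.

Lemma add_scaled_colon I u (G : ideal R) :
  G =i colon I u -> add_scaled I u G =i I.
Proof.
move=> eqG f; apply/add_scaledP/idP => [[g gI [h]]|fI].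
  by rewrite eqG colonE => hI ->; rewrite idealD.
by exists f => //; exists 0; rewrite ?ideal0 // mul0r addr0.
Qed.

Lemma add_scaled_full I u (G : ideal R) :
  G =i predT -> add_scaled I u G =i add_principal I u.
Proof.
move=> eqG f; apply/add_scaledP/add_principalP => -[g gI].
  by case=> h _ ->; exists g => //; exists h.
by case=> h ->; exists g => //; exists h; rewrite ?eqG.
Qed.

(** If a m u = g + h u with g in I and h in B, then a m - h lies in I : u, hence in B. Thus
    multiplying the generator m by u does not change its annihilator. *)
Lemma cyclic_factor_scaled I u A B P :
  {subset colon I u <= B} -> cyclic_factor A B P ->
  cyclic_factor (add_scaled I u A) (add_scaled I u B) P.
Proof.
move=> sB [m [mA genm annm]]; exists (m * u); split=> [|f|a].
- by apply/add_scaledP; exists 0; rewrite ?ideal0 //; exists m; rewrite ?add0r.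
- move=> /add_scaledP[g gI [h /genm[a hB] ->]]; exists a.
  apply/add_scaledP; exists g => //; exists (h - a * m) => //.
  by rewrite mulrBl mulrA addrA.
rewrite annm; apply/idP/add_scaledP => [mB|[g gI [h hB amu]]].
  by exists 0; rewrite ?ideal0 //; exists (a * m); rewrite // add0r mulrA.
by rewrite -(subrK h (a * m)) idealD // sB // colonE mulrBl -mulrA amu addrK.
Qed.

(** Since 1 lies in A, the generator m is invertible modulo B, so its annihilator modulo B is B
    itself. *)
Lemma prime_ideal_full_factor A B P :
  1 \in A -> {subset B <= A} -> cyclic_factor A B P -> B =i P.
Proof.
move=> A1 sBA [m [mA genm annm]] f; rewrite annm.
apply/idP/idP => [fB|fmB]; first by rewrite mulrC idealMl.
have [a] := genm _ A1; move/(idealMl f); rewrite mulrBr mulr1 => fB.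
by rewrite -(subrK (f * (a * m)) f) idealD // mulrCA idealMl.
Qed.

End IdealTheory.

(** * Monomial ideals and monomial generators of cyclic factors *)

Section MonomialIdeals.
Variables (n : nat) (K : fieldType).
Local Notation S := {mpoly K[n]}.
Implicit Types (I F G : ideal S) (u v w : 'X_{1..n}) (f g m : S).

Lemma idealX_lem I v w : (v <= w)%MM -> 'X_[v] \in I -> 'X_[w] \in I.
Proof. by move=> vw vI; rewrite -(submK vw) mpolyXD idealMl. Qed.

Lemma mpoly_ideal_msupp I f :
  (forall w, w \in msupp f -> 'X_[w] \in I) -> f \in I.
Proof.
move=> fI; rewrite [f]mpolyE big_seq.
apply: (big_ind (fun x => x \in I)) => [||w /fI wI].
- exact: ideal0.
- exact: idealD.
by rewrite -mul_mpolyC idealMl.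
Qed.

(** Every term of a combination of generators is a multiple of a generator. Conversely, the set of
    all monomials of I serves as generators, each element being the sum of its terms. *)
Lemma monomial_idealP I :
  monomial_ideal I <->
  (forall f, f \in I -> forall w, w \in msupp f -> 'X_[w] \in I).
Proof.
split=> [[G IG] f /IG[s sG ->] w|monI].
  have GI v : v \in G -> 'X_[v] \in I.
    move=> vG; apply/IG; exists [:: (1, v)]; last by rewrite big_seq1 mul1r.
    by move=> p; rewrite inE => /eqP->.
  elim: s sG => [|p s IHs] sG; first by rewrite big_nil msupp0.
  rewrite big_cons => /msuppD_le; rewrite mem_cat => /orP[|]; last first.
    by apply: IHs => q qs; apply: sG; rewrite inE qs orbT.
  move/msuppM_le => /allpairsP[[v1 v2] /= [_]].
  rewrite msuppX inE => /eqP-> ->.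
  by rewrite mpolyXD idealMl // GI // sG // mem_head.
exists (fun w => 'X_[w] \in I) => f; split=> [fI|[s sI ->]].
  exists [seq ((f@_w)%:MP, w) | w <- msupp f].
    by move=> _ /mapP[w wf ->] /=; apply: monI wf.
  by rewrite big_map {1}[f]mpolyE; apply: eq_bigr => w _; rewrite mul_mpolyC.
rewrite big_seq; apply: (big_ind (fun x => x \in I)) => [||p /sI pI].
- exact: ideal0.
- exact: idealD.
exact: idealMl.
Qed.

Lemma monomial_ideal_eq I F : I =i F -> monomial_ideal I -> monomial_ideal F.
Proof. by move=> eqI [G IG]; exists G => f; rewrite -eqI. Qed.

Lemma monomial_colon I u : monomial_ideal I -> monomial_ideal (colon I 'X_[u]).
Proof.
move/monomial_idealP=> monI; apply/monomial_idealP => f.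
rewrite colonE => fuI w wf; rewrite colonE -mpolyXD (monI _ fuI) //.
by rewrite (perm_mem (msuppMX f u)) addmC map_f.
Qed.

Lemma monomial_add_scaled I u G :
  monomial_ideal I -> monomial_ideal G ->
  monomial_ideal (add_scaled I 'X_[u] G).
Proof.
move=> /monomial_idealP monI /monomial_idealP monG; apply/monomial_idealP => f.
move=> /add_scaledP[g gI [h hG ->]] w /msuppD_le; rewrite mem_cat.
case/orP=> [wg|].
  by apply/add_scaledP; exists 'X_[w]; [exact: monI wg |
    exists 0; rewrite ?ideal0 ?mul0r ?addr0].
rewrite (perm_mem (msuppMX h u)) => /mapP[v vh ->].
apply/add_scaledP; exists 0; first exact: ideal0.
by exists 'X_[v]; [exact: monG vh | rewrite add0r addmC mpolyXD].
Qed.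

(** Once its term at w is subtracted, m has no monomial dividing w, so only that term, times the
    constant term of a, contributes at w. *)
Lemma mcoeffM_minimal a m w :
  (forall v, v \in msupp m -> (v <= w)%MM -> v = w) ->
  (a * m)@_w = a@_0%MM * m@_w.
Proof.
move=> minw; rewrite -{1}(subrK (m@_w *: 'X_[w]) m) mulrDr mcoeffD.
have aw : (a * 'X_[w])@_w = a@_0%MM by rewrite -{1}[w]addm0 mcoeffMX.
rewrite -scalerAr mcoeffZ aw [m@_w * _]mulrC.
rewrite [X in X + _]memN_msupp_eq0 ?add0r //; apply/negP.
move/msuppM_le=> /allpairsP[[v1 v2] /= [_ v2m wE]].
have v2w : v2 != w.
  apply: contraTneq v2m => ->.
  by rewrite mcoeff_msupp mcoeffB mcoeffZ mcoeffX eqxx mulr1 subrr eqxx.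
case/eqP: (v2w); apply: minw; last by rewrite wE lem_addl.
move: v2m; rewrite !mcoeff_msupp mcoeffB mcoeffZ mcoeffX.
by rewrite [w == v2]eq_sym (negPf v2w) mulr0 subr0.
Qed.

Lemma minimal_mdeg (p : pred 'X_{1..n}) v :
  p v -> exists2 w, p w & forall x, p x -> (mdeg w <= mdeg x)%N.
Proof.
move=> pv; pose q d := `[< exists2 w, p w & mdeg w = d >].
have exq : exists d, q d by exists (mdeg v); apply/asboolP; exists v.
case: (ex_minnP exq) => d /asboolP[w pw <-] mind.
by exists w => // x px; apply: mind; apply/asboolP; exists x.
Qed.

Lemma lem_mdeg_eq v w : (v <= w)%MM -> (mdeg w <= mdeg v)%N -> v = w.
Proof.
move=> vw; rewrite -{1}(submK vw) mdegD -{2}[mdeg v]add0n leq_add2r leqn0.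
by rewrite mdeg_eq0 -{2}(submK vw) => /eqP->; rewrite add0m.
Qed.

(* Graded Nakayama: a cyclic module F / I, with both ideals monomial, is
   generated by a monomial.  Modulo I, let v1 be a term of least degree of a
   generator m and write X^v1 = a m.  Comparing the coefficients at v1 shows
   that a has a nonzero constant term; if some term of m were not a multiple
   of X^v1, such a term of least degree would survive in a m. *)
Lemma cyclic_factor_monomial I F P :
  monomial_ideal I -> monomial_ideal F -> {subset I <= F} ->
  ~ {subset F <= I} -> cyclic_factor F I P ->
  exists u, F =i add_principal I 'X_[u] /\ colon I 'X_[u] =i P.
Proof.
move=> /monomial_idealP monI /monomial_idealP monF sIF nsFI [m [mF genm annm]].
have coefI w i : 'X_[w] \notin I -> i \in I -> i@_w = 0.
  by move=> wI iI; apply: memN_msupp_eq0; apply: contra wI => /(monI _ iI).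
pose p v := (v \in msupp m) && ('X_[v] \notin I).
(* If all terms of m were in I, then m would be in I, and so would all of F. *)
have [v0 pv0] : exists v, p v.
  apply: contrapT => nop; apply: nsFI => f /genm[a].
  rewrite -{2}(subrK (a * m) f) => faI; rewrite idealD // idealMl //.
  apply: mpoly_ideal_msupp => w wm; apply/negPn/negP => wI.
  by apply: nop; exists w; rewrite /p wm.
have [u /andP[um uI] minu] := minimal_mdeg pv0.
have uF : 'X_[u] \in F by exact: monF um.
have [a auI] := genm _ uF.
(* As X^w is outside I, X^u and a m have the same coefficient at w. A term of m dividing X^w is
   outside I too, so minimality among the exponents in [p] suffices. *)
have coefu w : 'X_[w] \notin I -> (forall v, p v -> (v <= w)%MM -> v = w) ->
    (u == w)%:R = a@_0%MM * m@_w.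
  move=> wI minw; rewrite -mcoeffM_minimal => [|v vm vw].
    by move/(coefI _ _ wI)/eqP: auI; rewrite mcoeffB subr_eq0 mcoeffX => /eqP.
  apply: minw (vw); rewrite /p vm.
  by apply: contra wI; apply: idealX_lem.
have a0 : a@_0%MM != 0.
  have /eqP : (u == u)%:R = a@_0%MM * m@_u.
    apply: coefu => // v pv vu; apply: lem_mdeg_eq vu _; exact: minu.
  by rewrite eqxx; apply: contraTneq => ->; rewrite mul0r oner_eq0.
have mult v : p v -> (u <= v)%MM.
  move=> pv; apply: contrapT => /negP nuv.
  have [|w /andP[pw nuw] minw] := @minimal_mdeg
    (fun v => p v && ~~ (u <= v)%MM) v; first by rewrite pv.
  have /andP[wm wI] := pw.
  have : (u == w)%:R = a@_0%MM * m@_w.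
    apply: coefu => // x px xw; apply: lem_mdeg_eq (xw) _; apply: minw.
    by rewrite px /=; apply: contra nuw => /lepm_trans; apply.
  case: eqP nuw => [->|_ _ /eqP]; first by rewrite lepm_refl.
  by rewrite eq_sym mulf_eq0 (negPf a0) -[m@_w == 0]negbK -mcoeff_msupp wm.
have mu : m \in add_principal I 'X_[u].
  apply: mpoly_ideal_msupp => w wm; apply/add_principalP.
  have [wI|wI] := boolP ('X_[w] \in I).
    by exists 'X_[w] => //; exists 0; rewrite mul0r addr0.
  exists 0; rewrite ?ideal0 //; exists 'X_[w - u].
  by rewrite add0r -mpolyXD submK // mult // /p wm.
(* Modulo I, m is a multiple of X^u by [mu] and X^u equals a m by [auI]; hence the two have the same
   annihilator and generate the same module. *)
exists u; split=> f; last first.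
  rewrite colonE annm; apply/idP/idP => [fuI|fmI].
    have /add_principalP[g gI [b ->]] := mu.
    rewrite mulrDr idealD //; first exact: idealMl.
    by rewrite mulrCA idealMl.
  rewrite -(subrK (a * m) 'X_[u]) mulrDr idealD //; first exact: idealMl.
  by rewrite mulrCA idealMl.
apply/idP/add_principalP => [/genm[b fI]|[g gI [b ->]]]; last first.
  by rewrite idealD ?idealMl // sIF.
have /add_principalP[g gI [c mE]] := mu.
exists (f - b * m + b * g); first by rewrite idealD ?idealMl.
by exists (b * c); rewrite -addrA -mulrA -mulrDr -mE subrK.
Qed.

End MonomialIdeals.

(** * Prime filtrations, their primes, and the two implications *)

Section Filtrations.
Variables (n : nat) (K : fieldType).
Local Notation S := {mpoly K[n]}.
Implicit Types (I J : ideal S) (F P : nat -> ideal S) (Q : {pred S}).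

Lemma filtration_factor I r F P j : prime_filtration I r F P ->
  (j < r)%N ->
  [/\ {subset F j <= F j.+1}, prime_ideal (P j.+1)
    & cyclic_factor (F j.+1) (F j) (P j.+1)].
Proof.
case=> _ _ _ FP jr; have [sF Pprime /isomorphic_subquotP cyc] := FP j.+1 jr.
by split.
Qed.

Lemma filtration_sub I r F P i j : prime_filtration I r F P ->
  (i <= j)%N -> (j <= r)%N -> {subset F i <= F j}.
Proof.
move=> FP; elim: j => [|j IHj]; first by rewrite leqn0 => /eqP-> _ f.
rewrite leq_eqVlt => /orP[/eqP-> _ f //|ij] jr f /(IHj ij (ltnW jr)).
by have [sF _ _] := filtration_factor FP jr; apply: sF.
Qed.

Lemma filtration_tail I J r F P : F 1 =i J -> prime_filtration I r.+1 F P ->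
  prime_filtration J r (fun j => F j.+1) (fun j => P j.+1).
Proof.
move=> F1 [_ Fr monF FP]; split=> // [j jr|[//|j] jr]; first exact: monF.
exact: (FP j.+2).
Qed.

(** Each of P_1, ..., P_i contains an element outside Q, which kills the corresponding factor. The
    product of these elements kills F_i / I and stays outside Q because Q is prime. *)
Lemma filtration_annihilator I r F P Q i : prime_filtration I r F P ->
  (i <= r)%N -> prime_ideal Q ->
  (forall j, (j < i)%N -> ~ {subset P j.+1 <= Q}) ->
  exists2 s, s \notin Q & forall f, f \in F i -> s * f \in I.
Proof.
move=> FP + Qprime; have [F0 _ _ _] := FP.
elim: i => [_ _|i IHi ir nPQ].
  by exists 1 => [|f]; rewrite ?prime_ideal1 // F0 mul1r.
have [|j ji|s sQ sF] := IHi; first exact: ltnW.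
  by apply: nPQ; apply: ltnW.
have [_ Pprime [m [mF genm annm]]] := filtration_factor FP ir.
have [t tP tQ] : exists2 t, t \in P i.+1 & t \notin Q.
  apply: contrapT => not; apply: (nPQ i (ltnSn i)) => t tP.
  by apply/negPn/negP => tQ; apply: not; exists t.
exists (s * t) => [|f /genm[a]]; first by rewrite prime_idealMr.
rewrite -{2}(subrK (a * m) f) => faF; rewrite -mulrA sF // mulrDr idealD //.
  exact: idealMl.
by rewrite mulrCA idealMl // -annm.
Qed.

(** The body of [pretty_clean] with its witnesses exposed, as needed to speak of the primes of a
    given filtration and to induct on its length. *)
Definition pretty_filtration I r F P : Prop :=
  prime_filtration I r F P /\
  forall i j, (0 < i)%N -> (i < j)%N -> (j <= r)%N ->
    {subset P i <= P j} -> P i =i P j.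

(* If no P_j with j < i lies in P_i, some s outside P_i kills F_(i-1) / I, and
   P_i is the annihilator of s m, for m a generator of F_i / F_(i-1).
   Otherwise such a P_j equals P_i. *)
Lemma pretty_filtration_ass I r F P i :
  pretty_filtration I r F P -> (0 < i <= r)%N -> ass I (P i).
Proof.
move=> [FP pretty]; elim/ltn_ind: i => -[//|i] IHi /= ir.
have [_ Pprime [m [mF genm annm]]] := filtration_factor FP ir.
have [[j ji PjP]|nPP] :=
  EM (exists2 j, (j < i)%N & {subset P j.+1 <= P i.+1}).
  rewrite (_ : (P i.+1 : {pred S}) = P j.+1); last first.
    by apply/funext => f; symmetry; apply: (pretty j.+1 i.+1).
  by apply: IHi; rewrite // (leq_trans _ ir) // ltnS ltnW.
apply/associatedP; split=> //.
have [|s sP sF] := filtration_annihilator FP (ltnW ir) Pprime.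
  by move=> j ji PjP; apply: nPP; exists j.
have [F0 _ _ _] := FP.
exists (s * m) => a; apply/idP/idP => [|asmI].
  by rewrite annm => /sF; rewrite mulrCA.
rewrite -(prime_idealMr _ Pprime sP) annm -mulrA.
by apply: (filtration_sub FP (leq0n i) (ltnW ir)); rewrite F0.
Qed.

(** Let Q be the annihilator of m modulo I. If some b m lies in F_1 but not in I, it has annihilator
    Q because b is outside the prime Q, and P_1 because nonzero elements of S / P_1 have annihilator
    P_1. Otherwise m has annihilator Q modulo F_1 as well, and the rest of the filtration
    applies. *)
Lemma ass_prime_filtration I r F P Q : prime_filtration I r F P -> ass I Q ->
  exists2 j, (0 < j <= r)%N & Q =i P j.
Proof.
move=> + /associatedP[Qprime].
elim: r I F P => [|r IHr] I F P FP [m Qm]; have [F0 Fr _ _] := FP.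
  have /negP[] := prime_ideal1 Qprime.
  by rewrite Qm -F0 Fr.
have [sF Pprime [m1 [m1F genm1 annm1]]] := filtration_factor FP (ltn0Sn r).
have [[b bmF bmI]|nbm] := EM (exists2 b, b * m \in F 1 & b * m \notin I).
  exists 1%N => // c; have bQ : b \notin Q by rewrite Qm.
  have [a] := genm1 _ bmF; rewrite F0 => bmaI.
  have aP : a \notin P 1.
    rewrite annm1 F0; apply: contra bmI => am1.
    by rewrite -(subrK (a * m1) (b * m)) idealD.
  rewrite -(prime_idealMr c Qprime bQ) -(prime_idealMr c Pprime aP).
  rewrite Qm annm1 F0 -!mulrA -{1}(subrK (a * m1) (b * m)) mulrDr.
  by rewrite idealDl // idealMl.
have [|j jr eqQ] := IHr _ _ _ (filtration_tail (fun=> erefl) FP).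
  exists m => a; apply/idP/idP => [|amF]; first by rewrite Qm -F0 => /sF.
  by rewrite Qm; apply/negPn/negP => amI; apply: nbm; exists a.
by exists j.+1 => //; case/andP: jr.
Qed.

(** The single step from I to S suffices; the unit ideal is written as I + S 1 to reuse an existing
    ideal structure. *)
Lemma pretty_clean_prime I :
  monomial_ideal I -> prime_ideal I -> pretty_clean I.
Proof.
move=> monI Iprime; pose one : ideal S := add_principal I 1.
have oneT : one =i predT.
  by move=> f; apply/add_principalP; exists 0; rewrite ?ideal0 //; exists f;
     rewrite add0r mulr1.
exists 1%N, (fun j => if j is 0 then I else one), (fun=> I).
split=> [|[//|i] [|[|j]]] //; split=> // [[//|j] _|[|[|j]]] //.
  by apply/monomial_idealP => f _ w _; rewrite oneT.
move=> _; split=> // [f _|]; first by rewrite oneT.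
apply/isomorphic_subquotP; exists 1; split=> [|f _|a].
- by rewrite oneT.
- by exists f; rewrite mulr1 subrr ideal0.
by rewrite mulr1.
Qed.

Lemma pretty_clean_cleaner I u : monomial_ideal I -> pretty_cleaner I u ->
  pretty_clean (colon I 'X_[u]) -> pretty_clean (add_principal I 'X_[u]) ->
  pretty_clean I.
Proof.
move=> monI [_ _ cleaner] [r [G [P [GP prettyP]]]] [s [H [Q [HQ prettyQ]]]].
have [G0 Gr monG _] := GP; have [H0 Hs monH _] := HQ.
(* The index r belongs to the first half, both for the ideals and for the primes. *)
pose F j : ideal S :=
  if (j <= r)%N then (add_scaled I 'X_[u] (G j) : ideal S) else H (j - r)%N.
pose PQ j := if (j <= r)%N then P j else Q (j - r)%N.
(* At the junction j = 0 both sides are I + S u, but only as sets, whence [=i]. *)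
have FH j : F (r + j)%N =i H j.
  case: j => [|j] f; last by rewrite /F leqNgt addnS ltnS leq_addr -addnS addKn.
  by rewrite addn0 /F leqnn add_scaled_full // H0.
exists (r + s)%N, F, PQ; split.
  split=> [f|f|j jrs|[//|j] /= jrs].
  - exact: add_scaled_colon.
  - by rewrite FH Hs.
  - rewrite /F; case: leqP => rj; last by apply: monH; rewrite leq_subLR.
    by apply: monomial_add_scaled => //; apply: monG.
  have [jr|rj] := ltnP j r.
    have [sG Pprime cyc] := filtration_factor GP jr.
    rewrite /F /PQ jr (ltnW jr); split=> //; first exact: add_scaledS.
    apply/isomorphic_subquotP; apply: cyclic_factor_scaled => // f.
    by rewrite -G0; apply: (filtration_sub GP (leq0n j) (ltnW jr)).
  rewrite -(subnKC rj) -addnS; set k := (j - r)%N.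
  have ks : (k < s)%N by rewrite -(ltn_add2l r) subnKC.
  have [sH Qprime cyc] := filtration_factor HQ ks.
  have -> : PQ (r + k.+1)%N = Q k.+1.
    by rewrite /PQ leqNgt addnS ltnS leq_addr -addnS addKn.
  have -> : F (r + k.+1)%N = H k.+1.
    by rewrite /F leqNgt addnS ltnS leq_addr -addnS addKn.
  split=> // [f|]; first by rewrite FH => /sH.
  by apply/isomorphic_subquotP; apply: cyclic_factor_eqr cyc => f; rewrite FH.
move=> i j i0 ij jrs; rewrite /PQ.
have [jr|rj] := leqP j r.
  by rewrite (leq_trans (ltnW ij) jr); apply: prettyP.
have Qj : (0 < j - r <= s)%N by rewrite subn_gt0 rj leq_subLR.
have [ir|ri] := leqP i r; last first.
  by apply: prettyQ; rewrite ?subn_gt0 ?ltn_sub2r ?leq_subLR.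
(* The indices straddle the junction: P_i is associated to I : u and Q_(j-r) to I + S u. *)
apply: cleaner.
  by apply: (pretty_filtration_ass (conj GP prettyP)); rewrite i0.
exact: (pretty_filtration_ass (conj HQ prettyQ)).
Qed.

Lemma pretty_k_clean_pretty_clean k I : pretty_k_clean k I -> pretty_clean I.
Proof.
elim=> {I} [I monI Iprime|I u monI cleaner _ _ clean_colon _ clean_add].
  exact: pretty_clean_prime.
exact: pretty_clean_cleaner clean_colon clean_add.
Qed.

(* Any monomial has at most n <= k + 1 variables when k = n, so the support
   condition is void. *)
Lemma pretty_filtration_clean I r F P : monomial_ideal I -> 1 \notin I ->
  pretty_filtration I r F P -> pretty_k_clean n I.
Proof.
elim: r I F P => [|r IHr] I F P monI I1 [FP pretty]; have [F0 Fr monF _] := FP.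
  by move: I1; rewrite -F0 Fr.
have [sF Pprime cyc] := filtration_factor FP (ltn0Sn r).
have IF : {subset I <= F 1} by move=> f; rewrite -F0; apply: sF.
have cycI : cyclic_factor (F 1) I (P 1) by apply: cyclic_factor_eqr cyc.
(* If F_1 is all of S, then S / I is isomorphic to S / P_1, so I = P_1 is prime. *)
have [F1|F1] := boolP (1 \in F 1).
  apply: pretty_k_clean_prime => //; apply: prime_ideal_eq Pprime => f.
  by rewrite (prime_ideal_full_factor F1 IF cycI).
have FI : ~ {subset F 1 <= I}.
  have [m [mF _ annm]] := cycI => /(_ _ mF) mI.
  by have /negP[] := prime_ideal1 Pprime; rewrite annm mul1r.
have [|u [Fu Pu]] := cyclic_factor_monomial monI _ IF FI cycI.
  exact: monF.
have uI : 'X_[u] \notin I.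
  by have := prime_ideal1 Pprime; rewrite -Pu colonE mul1r.
have FuP := filtration_tail Fu FP.
apply: (@pretty_k_clean_cleaner n K n I u) => //.
- split=> //.
    apply: contra F1 => uU; rewrite Fu; apply/add_principalP.
    exists 0; first exact: ideal0.
    by exists ('X_[u])^-1; rewrite add0r mulVr.
  move=> Q Q' /associatedP[Qprime [m Qm]] /(ass_prime_filtration FuP).
  case=> j /andP[j0 jr] Q'E QQ'.
  (* The ideal I : u = P_1 is prime, so it is its own only associated prime; [Q'] is the prime
     P_(j+1) of the original filtration, and prettiness compares the two. *)
  have QE : Q =i P 1.
    move=> f; rewrite Qm Pu prime_idealMr // -Pu.
    by have := prime_ideal1 Qprime; rewrite Qm mul1r.
  move=> f; rewrite QE Q'E; apply: (pretty 1%N j.+1) => //.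
  by move=> g; rewrite -QE -Q'E; apply: QQ'.
- by rewrite (leq_trans (max_card _)) // card_ord.
- apply: pretty_k_clean_prime; first exact: monomial_colon.
  by apply: prime_ideal_eq Pprime => f; rewrite Pu.
apply: IHr.
- by apply: monomial_ideal_eq Fu _; apply: monF.
- by rewrite -Fu.
by split; [exact: FuP | move=> i j i0 ij jr; apply: pretty].
Qed.

End Filtrations.

Theorem theorem2p6 (n : nat) (K : fieldType) (I : ideal {mpoly K[n]})
  (monI : monomial_ideal I) :
  (forall k : nat, pretty_k_clean k I -> pretty_clean I) /\
  (1 \notin I -> pretty_clean I -> exists k : nat, pretty_k_clean k I).
Proof.
split=> [k|I1 [r [F [P FP]]]]; first exact: pretty_k_clean_pretty_clean.
by exists n; apply: pretty_filtration_clean monI I1 FP.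
Qed.
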